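(* Let $\mathcal H^2$ be a two-dimensional complex Hilbert space with orthonormal basis $h_{01},h_{02}$, let $\lambda_0\in\mathbb C$ with $\operatorname{Im}\lambda_0>0$, let $T_a$ be the linear operator in $\mathcal H^2$ with matrix $\begin{pmatrix}\bar\lambda_0&0\\0&-\lambda_0\end{pmatrix}$ in this basis, let $K:\mathbb C^2\to\mathcal H^2$ be given by $K(c_1,c_2)^T=\sqrt{\operatorname{Im}\lambda_0}\,(c_1h_{01}+c_2h_{02})$, let $J_a=-I$ on $\mathbb C^2$, and let $$\Theta_a=\begin{pmatrix}T_a&K&J_a\\ \mathcal H^2&&\mathbb C^2\end{pmatrix}$$ be the canonical L-system with main operator $T_a$, channel operator $K$ and directing operator $J_a$. Then the c-Entropy $\mathcal S_a$ of $\Theta_a$ is $$\mathcal S_a=\ln\frac{|\lambda_0|^2-2\operatorname{Im}\lambda_0+1}{|\lambda_0|^2+2\operatorname{Im}\lambda_0+1}.$$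
   Context: $\operatorname{Im}T=\frac1{2i}(T-T^* )$. A canonical L-system is an array $\Theta=\begin{pmatrix}T&K&J\\ \mathcal H&&E\end{pmatrix}$, where $\mathcal H,E$ are Hilbert spaces with $\dim E<\infty$, $T$ is a bounded operator in $\mathcal H$ (main operator), $K:E\to\mathcal H$ is bounded (channel operator), $J$ is a bounded self-adjoint unitary operator in $E$ (directing operator), and $\operatorname{Im}T=KJK^*$. Its transfer function is $W_\Theta(z)=I-2iK^*(T-zI)^{-1}KJ$, $z\in\rho(T)$. The c-Entropy of $\Theta$ is $\mathcal S=-\operatorname{tr}\ln(|W_\Theta(-i)|)$, where $|W|=(W^*W)^{1/2}$. Conventions: $\ln 0=-\infty$; if $-i\notin\rho(T)$ (here exactly when $\lambda_0=i$), $\mathcal S$ is understood as the limit in $[-\infty,+\infty]$ of $-\operatorname{tr}\ln(|W_\Theta(z)|)$ as $z\to -i$, $z\neq -i$. *)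

(* Defs.v *)
From HB Require Import structures.
From mathcomp Require Import all_boot all_order all_algebra.
From mathcomp Require Import sesquilinear spectral complex.
From mathcomp Require Import all_classical all_reals all_analysis.

Set Implicit Arguments.
Unset Strict Implicit.
Unset Printing Implicit Defensive.

Import Order.TTheory GRing.Theory Num.Theory.
Import numFieldNormedType.Exports.

Local Open Scope classical_set_scope.
Local Open Scope ring_scope.
Local Open Scope complex_scope.

(* [hdot] is linear in its first argument and conjugate-linear in the second. *)
HB.mixin Record CompleteNormedModule_isHilbert (R : realType) H
    & CompleteNormedModule R[i] H := {
  hdot : {dot H for (@Num.conj R[i])} ;
  hdot_norm : forall x : H, hdot x x = `|x| ^+ 2
}.

#[short(type="hilbertType")]
HB.structure Definition Hilbert (R : realType) :=
  {H of CompleteNormedModule_isHilbert R H & CompleteNormedModule R[i] H}.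

(* An alias of ['rV] is needed: ['rV[R[i]]_n] carries the sup norm. *)
Definition l2space (R : realType) (n : nat) := 'rV[R[i]]_n.

Section L2Space.
Context (R : realType) (n : nat).
Local Notation C := R[i].
Local Notation V := (l2space R n).

HB.instance Definition _ := GRing.Lmodule.copy V 'rV[C]_n.

Definition l2dot : {dot V for (@Num.conj C)} := @dotmx C n.

Definition l2norm (x : V) : C := sqrtC (l2dot x x).

Let l2normD x y : l2norm (x + y) <= l2norm x + l2norm y.
Proof. by case: (triangle_lerif (@dotmx C n) x y). Qed.

Let l2normZ (l : C) x : l2norm (l *: x) = `|l| * l2norm x.
Proof.
by rewrite /l2norm dnormZ rootCMl ?exprn_ge0 // sqrCK.
Qed.

Let l2norm0 x : l2norm x = 0 -> x = 0.
Proof. by move=> /eqP; rewrite sqrt_dnorm_eq0 => /eqP. Qed.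

HB.instance Definition _ := Lmodule_isNormed.Build C V l2normD l2normZ l2norm0.

Let l2dot_norm (x : V) : l2dot x x = `|x| ^+ 2.
Proof. by rewrite sqrtCK. Qed.

Let l2dotE (x : V) : l2dot x x = \sum_j `|x 0 j| ^+ 2.
Proof.
rewrite /= dotmxE mxE; apply: eq_bigr => j _.
by rewrite !mxE normCK.
Qed.

Let coord_le_norm (x : V) j : `|x 0 j| <= `|x|.
Proof.
rewrite -(@ler_pXn2r _ 2) ?nnegrE // -l2dot_norm l2dotE (bigD1 j) //=.
by rewrite lerDl sumr_ge0 // => k _; rewrite exprn_ge0.
Qed.

Let norm_le_sum (x : V) : `|x| <= \sum_j `|x 0 j|.
Proof.
have {1}-> : x = \sum_j x 0 j *: (delta_mx 0 j : V) by exact: row_sum_delta.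
apply: le_trans (ler_norm_sum _ _ _) _; apply: ler_sum => j _.
rewrite normrZ -[leRHS]mulr1 ler_wpM2l //.
rewrite -(@ler_pXn2r _ 2) ?nnegrE // -l2dot_norm l2dotE (bigD1 j) //= big1.
  by rewrite addr0 mxE !eqxx normr1.
by move=> k /negPf kj; rewrite mxE kj andbF normr0 expr0n.
Qed.

Let Re_le (z : C) : `|complex.Re z|%:C <= `|z|.
Proof. exact: normc_ge_Re. Qed.

Let Im_le (z : C) : `|complex.Im z|%:C <= `|z|.
Proof.
case: z => a b; rewrite normc_def /= lecR -sqrtr_sqr ler_wsqrtr //.
by rewrite lerDr sqr_ge0.
Qed.

Let norm_le_ReIm (z : C) :
  `|z| <= (`|complex.Re z| + `|complex.Im z|)%:C.
Proof.
case: z => a b; rewrite normc_def /= lecR.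
rewrite -[leRHS]ger0_norm ?addr_ge0 // -sqrtr_sqr ler_wsqrtr //.
rewrite sqrrD !real_normK ?num_real // -addrA lerD2l lerDr.
by rewrite mulrn_wge0 // mulr_ge0.
Qed.

Let contraction_cvg (F : set_system V) (p : {additive V -> R}) :
  ProperFilter F -> cauchy F -> (forall x, `|p x|%:C <= `|x|) ->
  exists l : R, p x @[x --> F] --> l.
Proof.
move=> FF Fc pn; apply/cvg_ex.
apply: (@cauchy_cvg R (p @ F)); apply/cauchyP => e e0.
move/cauchyP : Fc => /(_ e%:C); rewrite ltcR => /(_ e0) [x Fx].
exists (p x); rewrite /nbhs /=; apply: (@filterS _ F _ (ball x e%:C)) => // y.
rewrite -!ball_normE /= => xy.
by rewrite -raddfB -ltcR (le_lt_trans (pn _)).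
Qed.

Let l2_complete (F : set_system V) : ProperFilter F -> cauchy F -> cvg F.
Proof.
move=> FF Fc.
have /choice[a Ha] j : exists l : R,
    complex.Re ((x : V) 0 j) @[x --> F] --> l.
  pose p (x : V) := complex.Re (x 0 j).
  have pA : zmod_morphism p by move=> x y; rewrite /p !mxE raddfB.
  pose pa := GRing.isZmodMorphism.Build V R p pA.
  pose P : {additive V -> R} := HB.pack p pa.
  apply: (@contraction_cvg F P) => // x.
  exact: le_trans (Re_le _) (coord_le_norm _ _).
have /choice[b Hb] j : exists l : R,
    complex.Im ((x : V) 0 j) @[x --> F] --> l.
  pose p (x : V) := complex.Im (x 0 j).
  have pA : zmod_morphism p by move=> x y; rewrite /p !mxE raddfB.
  pose pa := GRing.isZmodMorphism.Build V R p pA.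
  pose P : {additive V -> R} := HB.pack p pa.
  apply: (@contraction_cvg F P) => // x.
  exact: le_trans (Im_le _) (coord_le_norm _ _).
pose l : V := \row_j (a j +i* b j).
apply/cvg_ex; exists l.
apply/(@cvgrPdist_lt _ V _ F FF id) => -[e e'].
rewrite ltcE /= => /andP[/eqP -> e0].
pose d := e / (2 *+ n.+1).
have d0 : 0 < d by rewrite divr_gt0 // pmulrn_lgt0.
have near1 : \forall x \near F, forall j,
   `|a j - complex.Re ((x : V) 0 j)| < d /\ `|b j - complex.Im ((x : V) 0 j)| < d.
  apply: filter_forall => j.
  apply: filterI.
    by move/cvgrPdist_lt : (Ha j); apply.
  by move/cvgrPdist_lt : (Hb j); apply.
apply: filterS near1 => x Hx.
apply: le_lt_trans (norm_le_sum _) _.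
apply: (@le_lt_trans _ _ (\sum_(j < n) (d + d)%:C)).
  apply: ler_sum => j _; apply: le_trans (norm_le_ReIm _) _.
  rewrite lecR; have [/ltW h1 /ltW h2] := Hx j.
  by rewrite !mxE /=; case: (x 0 j) h1 h2 => u v /= h1 h2; exact: lerD.
rewrite sumr_const card_ord -rmorphMn ltcR.
have -> : e = d * (2 *+ n.+1) by rewrite divfK // gt_eqF // pmulrn_lgt0.
rewrite -mulr2n -mulrnA -[2 *+ n.+1]mulr_natr -natrM mulr_natr.
by rewrite ltr_pMn2l // ltn_pmul2l.
Qed.

HB.instance Definition _ := Uniform_isComplete.Build V l2_complete.

HB.instance Definition _ :=
  CompleteNormedModule_isHilbert.Build R V l2dot_norm.
End L2Space.

Section Operators.
Context (R : realType).
Local Notation C := R[i].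
Implicit Types H E : hilbertType R.

Definition bounded_op H E (A : H -> E) :=
  exists M : C, forall x, `|A x| <= M * `|x|.

Definition orthonormal_basis H n (e : n.-tuple H) :=
  orthonormal (@hdot R H) e /\
  forall x, exists c : 'I_n -> C, x = \sum_i c i *: tnth e i.

Definition finite_dim H := exists n (e : n.-tuple H), orthonormal_basis e.

Definition has_matrix H n (e : n.-tuple H) (A : H -> H) (M : 'M[C]_n) :=
  forall j, A (tnth e j) = \sum_i M i j *: tnth e i.

(* For a bounded linear [A], the vector picked is the only one with the stated *)
(* property, and it exists by the Riesz representation theorem.               *)
Definition adjoint H E (A : H -> E) : E -> H :=
  fun y => xget 0 [set z | forall x, hdot (A x) y = hdot x z].

Definition im_op H (A : H -> H) : H -> H :=
  fun x => (2 * 'i)^-1 *: (A x - adjoint A x).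

Definition resolvent_set H (T : H -> H) : set C :=
  [set z | exists S : {linear H -> H},
    [/\ bounded_op S,
        forall x, S (T x - z *: x) = x &
        forall x, T (S x) - z *: S x = x]].

(* [(T - z I)^-1], meaningful for [z] in [resolvent_set T] *)
Definition resolvent H (T : H -> H) (z : C) : H -> H :=
  fun y => xget 0 [set x | T x - z *: x = y].

(* [(A^* A)^(1/2)], the unique positive square root of [A^* A]; positivity in  *)
(* the order of [R[i]] includes that [hdot (B x) x] is real.                   *)
Definition abs_op E (A : E -> E) : E -> E :=
  @xget (E -> E) id [set B |
    [/\ linear B,
        forall x, 0 <= hdot (B x) x &
        forall x, B (B x) = adjoint A (A x)]].

(* For a positive [B] on a finite-dimensional space, [tr (ln B)] is the sum of *)
(* the logarithms of the eigenvalues of [B] along an orthonormal eigenbasis;   *)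
(* [lne 0 = -oo], so the sum is [-oo] when [B] is singular.                    *)
Definition tr_ln E (B : E -> E) : \bar R :=
  xget 0%E [set s | exists n (e : n.-tuple E) (a : 'I_n -> R),
    [/\ orthonormal_basis e,
        forall i, B (tnth e i) = (a i)%:C *: tnth e i &
        s = (\sum_(i < n) lne (a i)%:E)%E]].

End Operators.

Record lsystem (R : realType) (H E : hilbertType R) := LSystem {
  main_op : {linear H -> H} ;
  channel_op : {linear E -> H} ;
  directing_op : {linear E -> E}
}.

Section LSystems.
Context (R : realType) (H E : hilbertType R).
Implicit Types Theta : lsystem H E.

Definition canonical_lsystem Theta :=
  let T := main_op Theta in
  let K := channel_op Theta in
  let J := directing_op Theta in
  [/\ finite_dim E,
      [/\ bounded_op T, bounded_op K & bounded_op J],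
      forall x, adjoint J x = J x,
      (forall x, adjoint J (J x) = x) /\ (forall x, J (adjoint J x) = x) &
      forall x, im_op T x = K (J (adjoint K x))].

Definition transfer Theta (z : R[i]) : E -> E :=
  let T := main_op Theta in
  let K := channel_op Theta in
  let J := directing_op Theta in
  fun x => x - (2 * 'i) *: adjoint K (resolvent T z (K (J x))).

(* The first case also covers a singular [transfer Theta (- 'i)], where the    *)
(* value is [+oo]. In the second case [lim] is [0] if the limit does not exist.*)
Definition c_entropy Theta : \bar R :=
  let s z := (- tr_ln (abs_op (transfer Theta z)))%E in
  if `[< resolvent_set (main_op Theta) (- 'i) >] then s (- 'i)
  else lim (s z @[z --> (- 'i : R[i]^o)^']).

End LSystems.

(* Main.v *)
Require Import Defs.
From HB Require Import structures.
From mathcomp Require Import all_boot all_order all_algebra.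
From mathcomp Require Import sesquilinear spectral complex.
From mathcomp Require Import all_classical all_reals all_analysis.
From mathcomp Require Import ring lra.

Set Implicit Arguments.
Unset Strict Implicit.
Unset Printing Implicit Defensive.

Import Order.TTheory GRing.Theory Num.Theory.
Import numFieldNormedType.Exports.

Local Open Scope classical_set_scope.
Local Open Scope ring_scope.
Local Open Scope complex_scope.

(** In the orthonormal basis e the main operator is diagonal with eigenvalues
mu_i, all of imaginary part - b where b = Im lambda0, and the channel operator
is sqrt b times the unitary map sending the standard basis to e. Hence, with
J = - I, the operator K J K^* is - b I = Im T and the transfer function is
diagonal in the standard basis, with entries
  1 + 2 i b / (mu_i - z) = (mu_i^* - z) / (mu_i - z)
(transferE). If these entries have a common modulus s > 0, then W(z) is s times
a unitary operator, so |W(z)| = s I and tr ln |W(z)| is the dimension times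
ln s (transfer_trace_ln).

The two eigenvalues lambda0^* and - lambda0 are mirror images in the imaginary
axis, on which - i lies. At z = - i the moduli therefore agree:
s = |lambda0 + i| / |lambda0 - i|, and - 2 ln s is the logarithm of the quotient
of |lambda0 - i|^2 = |lambda0|^2 - 2 b + 1 by
|lambda0 + i|^2 = |lambda0|^2 + 2 b + 1 (entropy_regular).

When lambda0 = i both eigenvalues equal - i, which is then not regular. The
moduli agree at every z, with s = |z - i| / |z + i|; s tends to +oo as z tends
to - i, so the entropy is -oo, which is also the value of ln at the vanishing
quotient (entropy_singular). *)

(** * Orthonormal bases and adjoints *)

Section InnerProduct.
Variables (R : realType) (H E : hilbertType R).
Implicit Types x y z : H.

Lemma hdot_conj x y : hdot x y = ((hdot y x)^*)%R.
Proof. by rewrite hermC expr0 mul1r. Qed.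

Lemma hdot_inj y z : (forall x, hdot x y = hdot x z) -> y = z.
Proof.
move=> yz; apply/eqP; rewrite -subr_eq0 -(dnorm_eq0 (@hdot R H)).
by rewrite linearBr /= yz subrr.
Qed.

(** Adjoints are computed by guessing the answer: nondegeneracy of the inner
product makes it the only candidate. *)
Lemma adjointE (A : H -> E) (y : E) z :
  (forall x, hdot (A x) y = hdot x z) -> adjoint A y = z.
Proof.
move=> Az; apply: xget_unique => // u Au.
by apply: hdot_inj => x; rewrite -Au Az.
Qed.

End InnerProduct.

Section OrthonormalBasis.
Variables (R : realType) (H : hilbertType R) (n : nat) (e : n.-tuple H).
Hypothesis eB : orthonormal_basis e.
Implicit Types x y : H.

Lemma hdot_basis i j : hdot (tnth e i) (tnth e j) = (i == j)%:R.
Proof.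
have [/orthonormalP[/tuple_uniqP/inj_eq Ue] He _] := eB.
by rewrite He ?mem_tnth // Ue.
Qed.

Lemma hdot_comb (c : 'I_n -> R[i]) j :
  hdot (\sum_i c i *: tnth e i) (tnth e j) = c j.
Proof.
rewrite linear_sumlz (bigD1 j) //= linearZl_LR /= hdot_basis eqxx mulr1.
rewrite big1 ?addr0 // => i ij.
by rewrite linearZl_LR /= hdot_basis (negPf ij) mulr0.
Qed.

Lemma basis_expansion x : x = \sum_i hdot x (tnth e i) *: tnth e i.
Proof.
have [c {1 2}->] := eB.2 x.
by apply: eq_bigr => i _; rewrite hdot_comb.
Qed.

Lemma coord_inj x y :
  (forall i, hdot x (tnth e i) = hdot y (tnth e i)) -> x = y.
Proof.
move=> xy; rewrite (basis_expansion x) (basis_expansion y).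
by apply: eq_bigr => i _; rewrite xy.
Qed.

Lemma parseval x y :
  hdot x y = \sum_i hdot x (tnth e i) * (hdot y (tnth e i))^*.
Proof.
rewrite {1}(basis_expansion x) linear_sumlz; apply: eq_bigr => i _.
by rewrite linearZl_LR /= [hdot _ y]hdot_conj.
Qed.

Lemma coord_le_norm x i : `|hdot x (tnth e i)| <= `|x|.
Proof.
rewrite -(@ler_pXn2r _ 2) ?nnegrE // normCK -[`|x| ^+ 2]hdot_norm.
rewrite [leRHS]parseval (bigD1 i) //=.
by rewrite lerDl sumr_ge0 // => j _; rewrite mul_conjC_ge0.
Qed.

(** Each coordinate of x is at most |x|, so the sum of the norms of the images
of the basis vectors bounds the operator. *)
Lemma linear_bounded (E : hilbertType R) (A : {linear H -> E}) : bounded_op A.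
Proof.
exists (\sum_i `|A (tnth e i)|) => x.
rewrite {1}(basis_expansion x) linear_sum mulr_suml.
apply: le_trans (ler_norm_sum _ _ _) _; apply: ler_sum => i _.
by rewrite linearZ /= normrZ mulrC ler_wpM2l // coord_le_norm.
Qed.

End OrthonormalBasis.

(** Summing |<e_i, f_j>|^2 over all i and j gives the number of vectors of
either basis, by the Parseval identity applied in the other one. *)
Lemma basis_size_unique (R : realType) (H : hilbertType R) n m
    (e : n.-tuple H) (f : m.-tuple H) :
  orthonormal_basis e -> orthonormal_basis f -> n = m.
Proof.
move=> eB fB.
have dbl p q (u : p.-tuple H) (v : q.-tuple H) : orthonormal_basis u ->
    orthonormal_basis v ->
    p%:R = \sum_i \sum_j hdot (tnth u i) (tnth v j) *
                        (hdot (tnth u i) (tnth v j))^* :> R[i].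
  move=> uB vB; rewrite (eq_bigr (fun=> 1)); last first.
    by move=> i _; rewrite -parseval // hdot_basis // eqxx.
  by rewrite sumr_const card_ord.
apply/eqP; rewrite -(eqr_nat R[i]) (dbl _ _ _ _ eB fB) (dbl _ _ _ _ fB eB).
rewrite exchange_big /=; apply/eqP; apply: eq_bigr => i _.
apply: eq_bigr => j _.
by rewrite [hdot (tnth f i) _]hdot_conj conjCK mulrC.
Qed.

(** * Operators diagonal in an orthonormal basis *)

Section Diagonal.
Variables (R : realType) (H : hilbertType R) (n : nat) (e : n.-tuple H).
Variables (T : {linear H -> H}) (d : 'I_n -> R[i]).
Hypothesis eB : orthonormal_basis e.
Hypothesis Td : forall i, T (tnth e i) = d i *: tnth e i.
Implicit Types x y : H.

Lemma diag_coord x i : hdot (T x) (tnth e i) = d i * hdot x (tnth e i).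
Proof.
rewrite {1}(basis_expansion eB x) linear_sum.
under eq_bigr do rewrite linearZ /= Td scalerA.
by rewrite hdot_comb // mulrC.
Qed.

Lemma diag_adjoint_coord x i :
  hdot (adjoint T x) (tnth e i) = ((d i)^*)%R * hdot x (tnth e i).
Proof.
rewrite (@adjointE _ _ _ _ _
   (\sum_j ((d j)^* * hdot x (tnth e j)) *: tnth e j)) ?hdot_comb // => y.
rewrite !(parseval eB); apply: eq_bigr => j _.
by rewrite diag_coord hdot_comb // rmorphM /= conjCK mulrCA mulrA.
Qed.

Lemma diag_resolvent_coord z y i : (forall j, d j != z) ->
  hdot (resolvent T z y) (tnth e i) = (d i - z)^-1 * hdot y (tnth e i).
Proof.
move=> dz.
have dz0 j : d j - z != 0 by rewrite subr_eq0.
rewrite /resolvent (@xget_unique _ _ _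
  (\sum_j ((d j - z)^-1 * hdot y (tnth e j)) *: tnth e j)) ?hdot_comb //=.
  apply: (coord_inj eB) => j; rewrite linearBl linearZl_LR /= diag_coord.
  by rewrite hdot_comb //= -mulrBl mulVKf.
move=> x <-; apply: (coord_inj eB) => j.
by rewrite hdot_comb // linearBl linearZl_LR /= diag_coord /= -mulrBl mulKf.
Qed.

Lemma diag_resolvent_set z : (forall j, d j != z) -> resolvent_set T z.
Proof.
move=> dz.
have dz0 j : d j - z != 0 by rewrite subr_eq0.
pose S y := \sum_j ((d j - z)^-1 * hdot y (tnth e j)) *: tnth e j.
have Slin : linear S.
  move=> a x y; rewrite /S scaler_sumr -big_split /=; apply: eq_bigr => j _.
  by rewrite linearDl linearZl_LR /= scalerA -scalerDl mulrDr mulrCA.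
pose Sa := GRing.isLinear.Build R[i] H H _ S Slin.
pose SL : {linear H -> H} := HB.pack S Sa.
have SE x i : hdot (SL x) (tnth e i) = (d i - z)^-1 * hdot x (tnth e i).
  by rewrite /= hdot_comb.
exists SL; split=> [|x|x]; first exact: (linear_bounded eB SL).
  apply: (coord_inj eB) => j.
  by rewrite SE linearBl linearZl_LR /= diag_coord /= -mulrBl mulKf.
apply: (coord_inj eB) => j.
by rewrite linearBl linearZl_LR /= diag_coord SE /= -mulrBl mulVKf.
Qed.

Lemma diag_not_resolvent_set i : ~ resolvent_set T (d i).
Proof.
case=> S [_ /(_ (tnth e i)) + _].
rewrite Td subrr linear0 => ei0.
have := hdot_basis eB i i.
by rewrite -ei0 linear0l eqxx => /eqP; rewrite eq_sym oner_eq0.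
Qed.

End Diagonal.

(** * Multiples of isometries: modulus and trace of the logarithm *)

Section ScalarModulus.
Variables (R : realType) (E : hilbertType R).

(** If B is a positive square root of s^2 I, then v = B x - s x satisfies
B v = - s v; positivity of B then forces v = 0. *)
Lemma abs_op_scalar (W : E -> E) (s : R) : 0 < s ->
  (forall x, adjoint W (W x) = (s%:C ^+ 2) *: x) ->
  abs_op W = ( *:%R s%:C).
Proof.
move=> s0 WW; apply: xget_unique.
  split=> [a x y|x|x].
  - by rewrite scalerDr !scalerA mulrC.
  - by rewrite linearZl_LR mulr_ge0 ?dnorm_ge0 // lecR ltW.
  - by rewrite WW scalerA expr2.
move=> B [Blin Bpos BB]; apply/funext => x; apply/eqP; rewrite -subr_eq0.
pose Ba := GRing.isLinear.Build R[i] E E _ B Blin.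
pose BL : {linear E -> E} := HB.pack B Ba.
set v := B x - _.
have Bv : B v = - (s%:C *: v).
  rewrite /v -[B]/(BL : E -> E) linearB linearZ /= BB WW.
  by rewrite scalerBr opprB scalerA expr2.
have := Bpos v; rewrite Bv linearNl linearZl_LR /= oppr_ge0.
rewrite pmulr_rle0 ?ltcR // => v0.
by rewrite -(dnorm_eq0 (@hdot R E)) eq_le v0 dnorm_ge0.
Qed.

(** Every orthonormal eigenbasis of s I has s as its only eigenvalue, so the
value depends only on the number of basis vectors. *)
Lemma tr_ln_scalar n (e : n.-tuple E) (s : R) : orthonormal_basis e ->
  tr_ln ( *:%R s%:C : E -> E) = (\sum_(i < n) lne s%:E)%E.
Proof.
move=> eB; apply: xget_unique; first by exists n, e, (fun=> s).
move=> _ [m [f [a [fB fa ->]]]].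
have nm := basis_size_unique eB fB; subst m.
apply: eq_bigr => i _; congr (lne _%:E).
have := congr1 (fun x => hdot x (tnth f i)) (fa i).
by rewrite !linearZl_LR /= hdot_basis // eqxx !mulr1 => -[].
Qed.

End ScalarModulus.

(** * The standard basis of the coordinate space *)

Section StandardBasis.
Variables (R : realType) (n : nat).
Local Notation V := (l2space R n).

Lemma l2_hdotE (x y : V) : hdot x y = \sum_j x 0 j * (y 0 j)^*.
Proof.
rewrite [LHS](dotmxE x y) mxE; apply: eq_bigr => j _.
by rewrite !mxE.
Qed.

Definition l2basis : n.-tuple V := [tuple (delta_mx 0 i : V) | i < n].

Lemma l2_coord (x : V) j : hdot x (tnth l2basis j) = x 0 j.
Proof.
rewrite l2_hdotE tnth_mktuple (bigD1 j) //= big1 => [|i ij].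
  by rewrite mxE !eqxx conjC1 mulr1 addr0.
by rewrite mxE (negPf ij) andbF conjC0 mulr0.
Qed.

Lemma l2basis_orthonormal : orthonormal_basis l2basis.
Proof.
split; last first.
  move=> x; exists (fun j => x 0 j).
  rewrite [LHS]row_sum_delta; apply: eq_bigr => j _.
  by rewrite tnth_mktuple.
have He i j : hdot (tnth l2basis i) (tnth l2basis j) = (i == j)%:R.
  by rewrite l2_coord tnth_mktuple mxE eqxx eq_sym.
have Ie : injective (tnth l2basis).
  move=> i j ij; apply/eqP; have := He i j.
  by rewrite ij He eqxx; case: (i == j) => // /eqP; rewrite oner_eq0.
apply/orthonormalP; split; first exact/tuple_uniqP.
by move=> _ _ /tnthP[i ->] /tnthP[j ->]; rewrite He (inj_eq Ie).
Qed.

End StandardBasis.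

(** * L-systems with a diagonal main operator *)

(** The whole spectrum lies on the line Im z = - b, which is what lets a single
scalar sqrt b serve as channel constant in every direction. *)
Section DiagonalSystem.
Variables (R : realType) (H : hilbertType R) (n : nat) (e : n.-tuple H).
Variables (Theta : lsystem H (l2space R n)) (mu : 'I_n -> R[i]) (b : R).
Local Notation T := (main_op Theta).
Local Notation K := (channel_op Theta).
Local Notation J := (directing_op Theta).
Hypothesis eB : orthonormal_basis e.
Hypothesis Tmu : forall i, T (tnth e i) = mu i *: tnth e i.
Hypothesis KE : forall c : l2space R n,
  K c = (Num.sqrt b)%:C *: \sum_i c 0 i *: tnth e i.
Hypothesis JE : forall c : l2space R n, J c = - c.
Hypothesis b_gt0 : 0 < b.
Hypothesis Im_mu : forall i, complex.Im (mu i) = - b.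
Implicit Types (x y : H) (c : l2space R n).

Lemma mu_sub_conj i : mu i - ((mu i)^*)%R = - (2 * 'i * b%:C).
Proof.
have := Im_mu i; case: (mu i) => u v /= ->.
by apply/eqP; rewrite eq_complex /=; apply/andP; split; apply/eqP; ring.
Qed.

Lemma channel_coord c i :
  hdot (K c) (tnth e i) = (Num.sqrt b)%:C * c 0 i.
Proof. by rewrite KE linearZl_LR /= hdot_comb. Qed.

Lemma channel_adjoint_coord x i :
  (adjoint K x) 0 i = (Num.sqrt b)%:C * hdot x (tnth e i).
Proof.
rewrite (@adjointE _ _ _ _ _
  (\row_j ((Num.sqrt b)%:C * hdot x (tnth e j)) : l2space R n)) ?mxE // => c.
rewrite (parseval eB) l2_hdotE; apply: eq_bigr => j _.
by rewrite channel_coord mxE rmorphM /= [(_%:C^*)%R]conjc_real mulrCA mulrA.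
Qed.

Lemma directing_adjoint c : adjoint J c = - c.
Proof. by apply: adjointE => x; rewrite JE linearNl linearNr. Qed.

Lemma sqrt_b_sqr : (Num.sqrt b)%:C * (Num.sqrt b)%:C = b%:C.
Proof. by rewrite -rmorphM /= -expr2 sqr_sqrtr // ltW. Qed.

(** On the vector e_i, Im T acts by Im mu_i = - b, and K J K^* by
- sqrt b * sqrt b. *)
Lemma diagonal_canonical : canonical_lsystem Theta.
Proof.
have EB := l2basis_orthonormal R n.
split.
- by exists n, (l2basis R n).
- split; first exact: (linear_bounded eB).
  + exact: (linear_bounded EB).
  + exact: (linear_bounded EB).
- by move=> c; rewrite directing_adjoint JE.
- by split=> c; rewrite directing_adjoint JE opprK.
move=> x; apply: (coord_inj eB) => i.
rewrite channel_coord JE mxE channel_adjoint_coord /im_op linearZl_LR linearBl.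
rewrite /= (diag_coord eB Tmu) (diag_adjoint_coord eB Tmu) -mulrBl mu_sub_conj.
rewrite mulNr !mulrN [in RHS]mulrA sqrt_b_sqr -(mulrA (2 * _)) mulKf //.
by rewrite mulf_neq0 // ?pnatr_eq0 // neq0Ci.
Qed.

(** Stated as an equality of functions, so that later rewriting replaces the
transfer function by an explicit diagonal operator. *)
Lemma transferE z : (forall j, mu j != z) ->
  transfer Theta z =
  (fun c => \row_i ((((mu i)^*)%R - z) / (mu i - z) * c 0 i)).
Proof.
move=> muz; apply/funext => c; apply/rowP => i.
have muz0 : mu i - z != 0 by rewrite subr_eq0.
rewrite /transfer !mxE channel_adjoint_coord (diag_resolvent_coord eB Tmu) //.
rewrite channel_coord JE mxE.
have -> : ((mu i)^*)%R = mu i + 2 * 'i * b%:C.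
  by rewrite -[LHS](subrK (mu i)) -opprB mu_sub_conj opprK addrC.
by rewrite -sqrt_b_sqr; field.
Qed.

(** The hypothesis says that all the diagonal entries of W(z) have modulus s,
hence W(z)^* W(z) = s^2 I. *)
Lemma transfer_trace_ln z (s : R) : (forall j, mu j != z) -> 0 < s ->
  (forall j, `|((mu j)^*)%R - z| = s%:C * `|mu j - z|) ->
  tr_ln (abs_op (transfer Theta z)) = (\sum_(i < n) lne s%:E)%E.
Proof.
move=> muz s0 mus.
rewrite transferE //; set w := fun i => (((mu i)^*)%R - z) / (mu i - z).
rewrite (@abs_op_scalar _ _ _ s) //.
  exact: (tr_ln_scalar _ (l2basis_orthonormal R n)).
move=> c.
rewrite (@adjointE _ _ _ _ _
  (\row_i (((w i)^*)%R * (w i * c 0 i)) : l2space R n)).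
  apply/rowP => i; rewrite !mxE mulrA [_ * w i]mulrC -normCK.
  by rewrite /w normrM normfV mus mulfK // normr_eq0 subr_eq0.
move=> x; rewrite !l2_hdotE; apply: eq_bigr => i _.
by rewrite !mxE [in RHS]rmorphM /= conjCK mulrCA mulrA.
Qed.

End DiagonalSystem.

(** * A pair of eigenvalues symmetric in the imaginary axis *)

Section MirrorPair.
Variable R : realType.
Implicit Type l : R[i].

Lemma sqr_norm_addi l :
  `|l + 'i| ^+ 2 = (Normc.normc l ^+ 2 + 2 * complex.Im l + 1)%:C.
Proof.
case: l => a b; rewrite normCK /= sqr_sqrtr ?addr_ge0 ?sqr_ge0 //.
by apply/eqP; rewrite eq_complex /=; apply/andP; split; apply/eqP; ring.
Qed.

Lemma sqr_norm_subi l :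
  `|l - 'i| ^+ 2 = (Normc.normc l ^+ 2 - 2 * complex.Im l + 1)%:C.
Proof.
case: l => a b; rewrite normCK /= sqr_sqrtr ?addr_ge0 ?sqr_ge0 //.
by apply/eqP; rewrite eq_complex /=; apply/andP; split; apply/eqP; ring.
Qed.

Definition mirror_pair l (i : 'I_2) : R[i] := if i == 0 then (l^*)%R else - l.

Lemma Im_mirror_pair l i : complex.Im (mirror_pair l i) = - complex.Im l.
Proof. by rewrite /mirror_pair; case: ifP => _; case: l. Qed.

(** The two points are exchanged by the reflection z |-> - z^* in the imaginary
axis, and - 'i lies on that axis: hence the index i drops out of the distance
to - 'i, here and in the next lemma. *)
Lemma norm_mirror_pair_addi l i : `|mirror_pair l i + 'i| = `|l - 'i|.
Proof.
rewrite /mirror_pair; case: ifP => _.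
  by rewrite -[LHS]norm_conjC rmorphD /= conjCK conjCi.
by rewrite -normrN opprD opprK.
Qed.

Lemma norm_conj_mirror_pair_addi l i :
  `|((mirror_pair l i)^*)%R + 'i| = `|l + 'i|.
Proof.
rewrite /mirror_pair; case: ifP => _; first by rewrite conjCK.
by rewrite -[LHS]norm_conjC rmorphD /= conjCK conjCi -normrN opprD !opprK.
Qed.

End MirrorPair.

(** * The entropy *)

Section Entropy.
Variables (R : realType) (H : hilbertType R) (h01 h02 : H).
Variables (lambda0 : R[i]) (Theta_a : lsystem H (l2space R 2)).
Hypothesis hB : orthonormal_basis [tuple h01; h02].
Hypothesis l_gt0 : 0 < complex.Im lambda0.
Let mu := mirror_pair lambda0.
Hypothesis Tmu : forall i, main_op Theta_a (tnth [tuple h01; h02] i) =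
  mu i *: tnth [tuple h01; h02] i.
Hypothesis KE : forall c : l2space R 2, channel_op Theta_a c =
  (Num.sqrt (complex.Im lambda0))%:C *:
  \sum_i c 0 i *: tnth [tuple h01; h02] i.
Hypothesis JE : forall c : l2space R 2, directing_op Theta_a c = - c.

(** Here - 'i is a regular point, and s = |lambda0 + 'i| / |lambda0 - 'i| is the
modulus of both entries of the transfer function. *)
Lemma entropy_regular : lambda0 != 'i ->
  c_entropy Theta_a =
    lne ((Normc.normc lambda0 ^+ 2 - 2 * complex.Im lambda0 + 1) /
         (Normc.normc lambda0 ^+ 2 + 2 * complex.Im lambda0 + 1))%:E.
Proof.
move=> li; have li0 : 0 < `|lambda0 - 'i| by rewrite normr_gt0 subr_eq0.
set q := _ - _ + 1; set p := _ + _ + 1.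
have p0 : 0 < p.
  by rewrite ltr_wpDl // addr_ge0 ?sqr_ge0 // mulr_ge0 // ltW.
have q0 : 0 < q by rewrite -ltcR /q -sqr_norm_subi exprn_gt0.
have muNi j : mu j != - 'i.
  by rewrite -addr_eq0 -normr_eq0 norm_mirror_pair_addi gt_eqF.
set s := Num.sqrt (p / q).
have s0 : 0 < s by rewrite sqrtr_gt0 divr_gt0.
have s2 : s ^+ 2 = p / q by rewrite sqr_sqrtr // ltW // divr_gt0.
have norm_ratio : `|lambda0 + 'i| = s%:C * `|lambda0 - 'i|.
  apply/eqP; rewrite -(@eqrXn2 _ 2) ?mulr_ge0 ?normr_ge0 ?lecR ?(ltW s0) //.
  rewrite exprMn sqr_norm_addi sqr_norm_subi -/p -/q -rmorphXn /= s2.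
  by rewrite -rmorphM /= divfK // gt_eqF.
rewrite /c_entropy; cbv zeta; rewrite asboolT; last first.
  exact: (diag_resolvent_set hB Tmu).
rewrite (transfer_trace_ln hB Tmu KE JE l_gt0 (Im_mirror_pair lambda0)
  (s := s)) //.
  rewrite !big_ord_recl big_ord0 adde0 !lne_EFin ?divr_gt0 //.
  rewrite -EFinD -EFinN; congr (_%:E).
  have -> : q / p = (s ^+ 2)^-1 by rewrite s2 invf_div.
  by rewrite lnV ?posrE ?exprn_gt0 // lnXn // mulr2n.
by move=> j; rewrite !opprK norm_conj_mirror_pair_addi norm_mirror_pair_addi.
Qed.

(** Here - 'i is the only eigenvalue, and the entropy is the limit of
- 2 ln (|z - 'i| / |z + 'i|). *)
Lemma entropy_singular : lambda0 = 'i -> c_entropy Theta_a = -oo%E.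
Proof.
move=> li.
have muE j : mu j = - 'i.
  by rewrite /mu /mirror_pair li; case: ifP => _ //; rewrite conjCi.
rewrite /c_entropy; cbv zeta; rewrite asboolF; last first.
  by rewrite -(muE 0); exact: (diag_not_resolvent_set hB Tmu).
apply: cvg_lim; first exact: ereal_hausdorff.
apply/cvgeNyPle => A; rewrite near_withinE.
(* For |z + 'i| < 1 the numerator |z - 'i| is at least 1, so
   ln s >= - ln |z + 'i|, which exceeds - A / 2 once |z + 'i| < expR (A / 2). *)
have d0 : (0 : R[i]) < (Num.min 1 (expR (A / 2)))%:C.
  by rewrite ltcR lt_min ltr01 expR_gt0.
apply/nbhs_ballP; exists (Num.min 1 (expR (A / 2)))%:C => //= z.
rewrite -ball_normE /= => zd zi.
pose u := Normc.normc (- 'i - z); pose v := Normc.normc ('i - z).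
have zu : `|- 'i - z| = u%:C by rewrite /u normc_def; case: (- 'i - z).
have zv : `|'i - z| = v%:C by rewrite /v normc_def; case: ('i - z).
have u0 : 0 < u by rewrite -ltcR -zu normr_gt0 subr_eq0 eq_sym.
move: zd; rewrite zu ltcR lt_min => /andP[u1 uA].
have v1 : 1 <= v.
  (* 2 is the distance from - 'i to 'i *)
  suff : 2 <= u + v by move=> ?; lra.
  rewrite -lecR; have -> : (u + v)%:C = u%:C + v%:C by rewrite rmorphD.
  rewrite -zu -zv -[X in _ + X]normrN.
  apply: le_trans (ler_normD _ _).
  rewrite opprB addrA subrK -opprD normrN -mulr2n normrMn normCi.
  by rewrite (rmorph_nat (@real_complex R) 2).
have s0 : 0 < v / u by rewrite divr_gt0 // (lt_le_trans _ v1).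
rewrite (transfer_trace_ln hB Tmu KE JE l_gt0 (Im_mirror_pair lambda0)
  (s := v / u)) //.
- rewrite !big_ord_recl big_ord0 adde0 lne_EFin // -EFinD -EFinN lee_fin.
  suff : - (A / 2) <= ln (v / u) by move=> ?; lra.
  rewrite -[leLHS]expRK ler_ln ?posrE ?expR_gt0 // expRN.
  rewrite -[leLHS]mul1r ler_pM ?invr_ge0 ?expR_ge0 //.
  by rewrite lef_pV2 ?posrE ?expR_gt0 // ltW.
- by move=> j; rewrite muE eq_sym.
- move=> j; rewrite muE rmorphN /= conjCi opprK zu zv -rmorphM /=.
  by rewrite divfK // gt_eqF.
Qed.

End Entropy.

Theorem theorem4 (R : realType) (H : hilbertType R) (h01 h02 : H)
    (lambda0 : R[i]) (Theta_a : lsystem H (l2space R 2)) :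
  orthonormal_basis [tuple h01; h02] ->
  0 < complex.Im lambda0 ->
  has_matrix [tuple h01; h02] (main_op Theta_a)
    (\matrix_(i < 2, j < 2)
       (nth [::] [:: [:: lambda0^*; 0]; [:: 0; - lambda0]] i)`_j) ->
  (forall c : l2space R 2, channel_op Theta_a c =
     (Num.sqrt (complex.Im lambda0))%:C *: (c 0 0 *: h01 + c 0 1 *: h02)) ->
  (forall c : l2space R 2, directing_op Theta_a c = - c) ->
  canonical_lsystem Theta_a /\
  c_entropy Theta_a =
    lne ((Normc.normc lambda0 ^+ 2 - 2 * complex.Im lambda0 + 1) /
         (Normc.normc lambda0 ^+ 2 + 2 * complex.Im lambda0 + 1))%:E.
Proof.
move=> hB l_gt0 TM Kh JE.
have Tmu i : main_op Theta_a (tnth [tuple h01; h02] i) =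
    mirror_pair lambda0 i *: tnth [tuple h01; h02] i.
  rewrite TM !big_ord_recl big_ord0 addr0 !mxE.
  by case: i => -[|[|//]] ? /=; rewrite scale0r ?add0r ?addr0.
have KE c : channel_op Theta_a c = (Num.sqrt (complex.Im lambda0))%:C *:
    \sum_i c 0 i *: tnth [tuple h01; h02] i.
  rewrite Kh !big_ord_recl big_ord0 addr0.
  by congr (_ *: (_ *: _ + c 0 _ *: _)); apply/val_inj.
split.
  exact: (diagonal_canonical hB Tmu KE JE l_gt0 (Im_mirror_pair lambda0)).
have [li|li] := eqVneq lambda0 'i; last first.
  exact: (entropy_regular hB l_gt0 Tmu KE JE li).
rewrite (entropy_singular hB l_gt0 Tmu KE JE li) le0_lneNy // lee_fin.
suff -> : Normc.normc lambda0 ^+ 2 - 2 * complex.Im lambda0 + 1 = 0.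
  by rewrite mul0r.
have := sqr_norm_subi lambda0.
by rewrite {1}li subrr normr0 expr0n => -[].
Qed.
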